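(* Let $\lambda>0$. For every $i\ge 0$ and every $s\in[-1,1]$ with $U_\lambda(s)\neq 0$, $$L_i(\lambda,s):=\sum_{j=0}^\infty\phi^*_{ij}(\lambda)s^j=\frac{B_c(s)\phi^*_{i0}(\lambda)+\sum_{k=1}^{c-1}\phi^*_{ik}(\lambda)s^k[B_c(s)-B_k(s)]-s^{i+1}}{U_\lambda(s)}.$$ In particular, $\phi^*_{00}(\lambda)=\frac1\lambda$, whilst for $i,j\ge 1$, $$\phi^*_{i0}(\lambda)=\frac{u(\lambda)^i-\sum_{k=1}^{c-1}\phi^*_{ik}(\lambda)u(\lambda)^{k-1}(c-k)b_0(1-u(\lambda))}{\lambda}\quad\text{and}\quad \phi^*_{0j}(\lambda)=0,$$ where $u(\lambda)$ is the unique root of $U_\lambda(s)=0$ on $[0,1]$.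
   Context: Let $\mathbf E=\{0,1,2,\dots\}$ and let $c\ge 1$ be an integer (the number of servers). Let $(b_j)_{j\ge0}$ be reals with $b_j\ge 0$ for $j\ne 1$, $0<-b_1=\sum_{j\ne1}b_j<\infty$, $b_0>0$ and $\sum_{j\ge2}b_j>0$. The stopped $M^X/M/c$ queue has the conservative bounded $q$-matrix $Q^*=(q^*_{ij};\ i,j\in\mathbf E)$ given by $q^*_{i,i-1}=\min(i,c)b_0$, $q^*_{ii}=b_1-[\min(i,c)-1]b_0$, $q^*_{ij}=b_{j-i+1}$ ($j\ge i+1$) for $i\ge1$, and $q^*_{ij}=0$ otherwise (so state $0$ is absorbing). Let $(p^*_{ij}(t))$ be its (unique) transition function and $\phi^*_{ij}(\lambda)=\int_0^\infty e^{-\lambda t}p^*_{ij}(t)\,dt$ ($\lambda>0$) its resolvent. Define $B(s)=\sum_{j\ge0}b_js^j$, $B_i(s)=B(s)+(i-1)b_0(1-s)$ for $i=1,\dots,c$, and $U_\lambda(s)=B_c(s)-\lambda s$. For each $\lambda>0$ the equation $U_\lambda(s)=0$ has exactly one root $u(\lambda)$ on $[0,1]$, and $0<u(\lambda)<1$. Empty sums are $0$. *)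

(* Defs.v *)
From Stdlib Require Import Reals Lra Lia Arith.
From Coquelicot Require Import Coquelicot.
Open Scope R_scope.

Definition kron (i j : nat) : R := if Nat.eqb i j then 1 else 0.

(** Standard, possibly dishonest (row sums at most [1]) transition functions on
    the state space [nat]. Only the values at times [t >= 0] are constrained. *)
Record transition_function (p : nat -> nat -> R -> R) : Prop := {
  tf_ge0 : forall i j t, 0 <= t -> 0 <= p i j t;
  tf_row : forall i t, 0 <= t ->
    ex_series (fun j => p i j t) /\ Series (fun j => p i j t) <= 1;
  tf_init : forall i j, p i j 0 = kron i j;
  tf_CK : forall i j s t, 0 <= s -> 0 <= t ->
    is_series (fun k => p i k s * p k j t) (p i j (s + t));
  tf_std : forall i j, filterlim (p i j) (at_right 0) (locally (kron i j))
}.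

Definition has_q_matrix (p : nat -> nat -> R -> R) (q : nat -> nat -> R) : Prop :=
  forall i j,
    filterlim (fun t => (p i j t - p i j 0) / t) (at_right 0) (locally (q i j)).

(** For a standard transition function [p i j] is bounded and continuous on
    [0, oo), so for [0 < lambda] the improper Riemann integral exists. *)
Definition resolvent (p : nat -> nat -> R -> R) (lambda : R) (i j : nat) : R :=
  RInt_gen (fun t => exp (- lambda * t) * p i j t)
           (at_point 0) (Rbar_locally p_infty).

Record queue_rates (b : nat -> R) : Prop := {
  qr_ge0 : forall j, j <> 1%nat -> 0 <= b j;
  qr_b1 : 0 < - b 1%nat;
  qr_sum : is_series (fun j => if Nat.eqb j 1 then 0 else b j) (- b 1%nat);
  qr_b0 : 0 < b 0%nat;
  qr_tail : 0 < Series (fun j => b (j + 2)%nat)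
}.

Definition Qstar (c : nat) (b : nat -> R) (i j : nat) : R :=
  if Nat.eqb i 0 then 0
  else if Nat.eqb (j + 1) i then INR (Nat.min i c) * b 0%nat
  else if Nat.eqb j i then b 1%nat - (INR (Nat.min i c) - 1) * b 0%nat
  else if Nat.ltb i j then b (j - i + 1)%nat
  else 0.

Definition Bgen (b : nat -> R) (s : R) : R := PSeries b s.

Definition Bsrv (b : nat -> R) (i : nat) (s : R) : R :=
  Bgen b s + (INR i - 1) * b 0%nat * (1 - s).

Definition U (c : nat) (b : nat -> R) (lambda s : R) : R :=
  Bsrv b c s - lambda * s.

(* Main.v *)
Require Import Defs.
From Stdlib Require Import Reals Lra Lia Arith Classical Ranalysis5.
From Coquelicot Require Import Coquelicot.
Open Scope R_scope.

(** The formula is the generating function of the forward equation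
    [lambda * phi i j - kron i j = sum_k phi i k * q k j] of the resolvent.

    That equation has to be derived from the entrywise derivative of [p] at time
    [0]. Boundedness of the q-matrix makes this possible: by supermultiplicativity
    of [p k k] and Bernoulli's inequality ([tf_diag_lower]) the probability of
    having left [k] by time [h] is at most [M * h], with [M] independent of [k].
    Hence the transition probabilities are Lipschitz, and dominated convergence
    ([tannery]) applied to the Chapman-Kolmogorov equations gives the forward
    equation for the right derivatives ([tf_right_derive]). State [j] can be
    entered only from [k <= j + 1], so the right-hand side is a finite sum of
    continuous functions; the equation can be integrated ([RInt_right_derive]) and
    its Laplace transform taken by parts ([resolvent_forward]).

    A row of the q-matrix is a shift of [b] plus [min k c - 1] additional services,
    so summing the equations against [s ^ (j + 1)] turns them into an identity
    between [U * L_i], [Bsrv] and the finitely many terms with [1 <= k < c]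
    ([generating_identity]). Absolute convergence makes it valid for all [s] in
    [[-1, 1]]. Dividing by [U] gives the first claim. Evaluating at the root [u]
    of [U], whose existence and uniqueness come from convexity ([U_root]), and
    using [Bsrv b c u = lambda * u], gives the formula for [phi i 0]. State [0] is
    absorbing, which settles the row [i = 0]. *)

(** * Limits at [0] from the right *)

Definition right_lim (f : R -> R) (l : R) : Prop :=
  filterlim f (at_right 0) (locally l).

(** The later convergence arguments combine several error terms at an explicit
    small time, for which this form of the limit is the convenient one. *)
Lemma right_lim_eps (f : R -> R) (l : R) :
  right_lim f l <->
  (forall eps, 0 < eps ->
     exists d, 0 < d /\ forall h, 0 < h < d -> Rabs (f h - l) < eps).
Proof.
  unfold right_lim; split.
  - intros H eps He.
    apply filterlim_locally with (eps := mkposreal eps He) in H.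
    destruct H as [d Hd]. exists d; split; [apply cond_pos|].
    intros h [h0 hd]. apply (Hd h); [|exact h0].
    change (Rabs (h - 0) < d). rewrite Rabs_pos_eq; lra.
  - intros H. apply filterlim_locally. intros eps.
    destruct (H eps (cond_pos eps)) as (d & d0 & Hd).
    exists (mkposreal d d0). intros h Hh h0. apply Hd. split; [exact h0|].
    change (Rabs (h - 0) < d) in Hh. rewrite Rabs_pos_eq in Hh; lra.
Qed.

Lemma filterlim_add {T : Type} {F : (T -> Prop) -> Prop} {FF : Filter F}
  (f g : T -> R) (l m : R) :
  filterlim f F (locally l) -> filterlim g F (locally m) ->
  filterlim (fun x => f x + g x) F (locally (l + m)).
Proof.
  intros Hf Hg. eapply filterlim_comp_2; [exact Hf | exact Hg |].
  apply (filterlim_plus (V := R_NormedModule)).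
Qed.

Lemma filterlim_mult_const {T : Type} {F : (T -> Prop) -> Prop} {FF : Filter F}
  (c : R) (f : T -> R) (l : R) :
  filterlim f F (locally l) -> filterlim (fun x => c * f x) F (locally (c * l)).
Proof.
  intros Hf. eapply filterlim_comp; [exact Hf|].
  apply (filterlim_scal_r (V := R_NormedModule) c l).
Qed.

Lemma filterlim_sum_n {T : Type} {F : (T -> Prop) -> Prop} {FF : Filter F}
  (f : nat -> T -> R) (l : nat -> R) (N : nat) :
  (forall k, filterlim (f k) F (locally (l k))) ->
  filterlim (fun x => sum_n (fun k => f k x) N) F (locally (sum_n l N)).
Proof.
  intros H. induction N as [|N IH].
  - apply filterlim_ext with (f 0%nat); [intros x; now rewrite sum_O|].
    rewrite sum_O. apply H.
  - rewrite sum_Sn.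
    apply filterlim_ext with (fun x => sum_n (fun k => f k x) N + f (S N) x);
      [intros x; now rewrite sum_Sn|].
    apply (filterlim_add _ _ _ _ IH (H (S N))).
Qed.

Lemma right_lim_ext (f g : R -> R) (l : R) :
  (forall h, 0 < h -> f h = g h) -> right_lim f l -> right_lim g l.
Proof.
  rewrite !right_lim_eps. intros E H eps He.
  destruct (H eps He) as (d & d0 & Hd). exists d; split; [exact d0|].
  intros h Hh. rewrite <- E by lra. now apply Hd.
Qed.

Lemma right_lim_ge (f : R -> R) (l m : R) :
  (forall h, 0 < h -> m <= f h) -> right_lim f l -> m <= l.
Proof.
  rewrite right_lim_eps. intros Hm H.
  destruct (Rle_lt_dec m l) as [|C]; [assumption|exfalso].
  destruct (H (m - l)) as (d & d0 & Hd); [lra|].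
  specialize (Hd (d / 2)). specialize (Hm (d / 2)).
  assert (0 < d / 2 < d) by lra.
  specialize (Hd H0). apply Rabs_def2 in Hd. lra.
Qed.

(** * Series of real numbers *)

Lemma sum_n_eq (a d : nat -> R) (N : nat) :
  (forall k, (k <= N)%nat -> a k = d k) -> sum_n a N = sum_n d N :> R.
Proof. exact (sum_n_ext_loc a d N). Qed.

Lemma sum_n_add (a d : nat -> R) (N : nat) :
  sum_n (fun k => a k + d k) N = sum_n a N + sum_n d N :> R.
Proof. exact (sum_n_plus a d N). Qed.

Lemma sum_n_mult_const (c : R) (a : nat -> R) (N : nat) :
  sum_n (fun k => c * a k) N = c * sum_n a N.
Proof. exact (sum_n_mult_l c a N). Qed.

Lemma is_series_mult_const_l (c : R) (a : nat -> R) (l : R) :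
  is_series a l -> is_series (fun k => c * a k) (c * l).
Proof. intros H. exact (is_series_scal_l c a l H). Qed.

Lemma is_series_add (a b : nat -> R) (la lb : R) :
  is_series a la -> is_series b lb -> is_series (fun k => a k + b k) (la + lb).
Proof. intros H K. exact (is_series_plus a b la lb H K). Qed.

Lemma is_series_sub (a b : nat -> R) (la lb : R) :
  is_series a la -> is_series b lb -> is_series (fun k => a k - b k) (la - lb).
Proof. intros H K. exact (is_series_minus a b la lb H K). Qed.

Lemma is_series_shift (s : R) (a : nat -> R) (l : R) :
  is_series a l ->
  is_series (fun n => match n with O => 0 | S m => s * a m end) (s * l).
Proof.
  intros H. apply (is_series_decr_1 (V := R_NormedModule)).
  change (is_series (fun k => s * a k) (s * l + - 0)).
  rewrite Ropp_0, Rplus_0_r. now apply is_series_mult_const_l.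
Qed.

Lemma is_series_finite (a : nat -> R) (N : nat) :
  (forall k, (N < k)%nat -> a k = 0) -> is_series a (sum_n a N).
Proof.
  intros H. apply filterlim_ext_loc with (fun _ => sum_n a N);
    [|apply filterlim_const].
  exists N. intros n Hn. induction Hn as [|n Hn IH]; [reflexivity|].
  rewrite sum_Sn, H by lia. rewrite <- IH. symmetry; apply Rplus_0_r.
Qed.

(** Lets the term [p i j t], and more generally any single coefficient, take part
    in a termwise combination of series. *)
Lemma is_series_kron (a : nat -> R) (j : nat) :
  is_series (fun k => a k * kron k j) (a j).
Proof.
  replace (a j) with (sum_n (fun k => a k * kron k j) j).
  - apply is_series_finite. intros k Hk. unfold kron.
    destruct (Nat.eqb_spec k j); [lia | ring].
  - destruct j as [|j].
    + rewrite sum_O. unfold kron; simpl; ring.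
    + rewrite sum_Sn. unfold kron at 2. rewrite Nat.eqb_refl.
      rewrite (sum_n_ext_loc _ (fun _ => 0)).
      * rewrite sum_n_const. unfold plus; simpl; ring.
      * intros k Hk. unfold kron. destruct (Nat.eqb_spec k (S j)); [lia|apply Rmult_0_r].
Qed.

Lemma sum_n_kron (a : nat -> R) (j N : nat) :
  (j <= N)%nat -> sum_n (fun k => a k * kron k j) N = a j :> R.
Proof.
  intros H.
  assert (HF : is_series (fun k => a k * kron k j) (sum_n (fun k => a k * kron k j) N)).
  { apply is_series_finite. intros k Hk. unfold kron.
    destruct (Nat.eqb_spec k j); [lia|apply Rmult_0_r]. }
  apply is_series_unique in HF. rewrite <- HF.
  apply is_series_unique, is_series_kron.
Qed.

Lemma is_series_le (a b : nat -> R) (la lb : R) :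
  (forall k, a k <= b k) -> is_series a la -> is_series b lb -> la <= lb.
Proof.
  intros H Ha Hb. refine (filterlim_le (F := eventually) _ _ la lb _ Ha Hb).
  exists 0%nat. intros n _. now apply sum_n_m_le.
Qed.

Lemma is_series_truncate (a : nat -> R) (N : nat) :
  is_series (fun k => if (k <=? N)%nat then a k else 0) (sum_n a N).
Proof.
  rewrite (sum_n_ext_loc a (fun k => if (k <=? N)%nat then a k else 0)).
  - apply is_series_finite. intros k Hk.
    destruct (Nat.leb_spec k N); [lia|reflexivity].
  - intros k Hk. destruct (Nat.leb_spec k N); [reflexivity|lia].
Qed.

Lemma sum_n_le_is_series (a : nat -> R) (l : R) (N : nat) :
  (forall k, 0 <= a k) -> is_series a l -> sum_n a N <= l.
Proof.
  intros H Ha. refine (is_series_le _ a _ _ _ (is_series_truncate a N) Ha).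
  intros k. specialize (H k). simpl. destruct (k <=? N)%nat; lra.
Qed.

Lemma is_series_term_le (a : nat -> R) (l : R) (j : nat) :
  (forall k, 0 <= a k) -> is_series a l -> a j <= l.
Proof.
  intros H Ha. refine (is_series_le _ _ _ _ _ (is_series_kron a j) Ha).
  intros k. specialize (H k). unfold kron. destruct (k =? j)%nat; lra.
Qed.

Lemma is_series_two_terms_le (a : nat -> R) (l : R) (i j : nat) :
  i <> j -> (forall k, 0 <= a k) -> is_series a l -> a i + a j <= l.
Proof.
  intros Hij H Ha.
  refine (is_series_le _ _ _ _ _
            (is_series_add _ _ _ _ (is_series_kron a i) (is_series_kron a j)) Ha).
  intros k. specialize (H k). unfold kron.
  destruct (Nat.eqb_spec k i), (Nat.eqb_spec k j); lra || lia.
Qed.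

(** Row sums of a transition function are at most [1], so a weight bounded by [M]
    costs at most a factor [M]: this is what makes all later estimates uniform. *)
Lemma is_series_bounded_mult (a g : nat -> R) (M S l : R) :
  (forall k, 0 <= a k) -> (forall k, Rabs (g k) <= M) ->
  is_series a l -> is_series (fun k => a k * g k) S -> Rabs S <= M * l.
Proof.
  intros Ha Hg Hl HS. apply Rabs_le. split.
  - replace (- (M * l)) with (- M * l) by ring.
    refine (is_series_le _ _ _ _ _ (is_series_mult_const_l (- M) _ _ Hl) HS).
    intros k. specialize (Ha k). specialize (Hg k). apply Rabs_le_between in Hg. nra.
  - refine (is_series_le _ _ _ _ _ HS (is_series_mult_const_l M _ _ Hl)).
    intros k. specialize (Ha k). specialize (Hg k). apply Rabs_le_between in Hg. nra.
Qed.

Lemma ex_series_bounded_mult (a g : nat -> R) (M : R) :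
  (forall k, 0 <= a k) -> (forall k, Rabs (g k) <= M) ->
  ex_series a -> ex_series (fun k => Rabs (a k * g k)).
Proof.
  intros Ha Hg Hl.
  apply (ex_series_le (V := R_CompleteNormedModule) _ (fun k => M * a k)).
  - intros k. change (Rabs (Rabs (a k * g k)) <= M * a k).
    rewrite Rabs_Rabsolu, Rabs_mult, Rabs_pos_eq by apply Ha.
    rewrite Rmult_comm. apply Rmult_le_compat_r; auto.
  - exact (ex_series_scal_l M a Hl).
Qed.

(** Dominated convergence for series (Tannery): beyond a large index the terms
    contribute at most [2 * M] times a small tail of [a], and the finitely many
    others converge one by one. *)
Lemma tannery (a : nat -> R) (g : nat -> R -> R) (l : nat -> R) (T : R -> R)
  (M L : R) :
  (forall k, 0 <= a k) -> ex_series a ->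
  (forall k h, 0 < h -> Rabs (g k h) <= M) ->
  (forall k, right_lim (g k) (l k)) ->
  (forall h, 0 < h -> is_series (fun k => a k * g k h) (T h)) ->
  is_series (fun k => a k * l k) L ->
  right_lim T L.
Proof.
  intros Ha [A HA] Hg Hl HT HL.
  assert (M0 : 0 <= M) by (eapply Rle_trans; [apply Rabs_pos | apply (Hg 0%nat 1); lra]).
  assert (Hlb : forall k, Rabs (l k) <= M).
  { intros k. apply Rabs_le. split.
    - apply right_lim_ge with (2 := Hl k). intros h h0.
      specialize (Hg k h h0). apply Rabs_le_between in Hg. lra.
    - apply Ropp_le_cancel.
      apply right_lim_ge with (fun h => -1 * g k h).
      + intros h h0. specialize (Hg k h h0). apply Rabs_le_between in Hg. lra.
      + replace (- l k) with (-1 * l k) by ring. apply filterlim_mult_const, Hl. }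
  apply right_lim_eps. intros eps He.
  (* a tail of [a] below this bound, weighted by [2 * M], stays below [eps / 2] *)
  assert (He' : 0 < eps / (4 * (M + 1))) by (apply Rdiv_lt_0_compat; lra).
  destruct (proj1 (filterlim_locally (F := eventually) (sum_n a) A) HA
              (mkposreal _ He')) as [N HN].
specialize (HN N (le_n N)).
  change (Rabs (sum_n a N - A) < eps / (4 * (M + 1))) in HN.
  set (u := fun k h => a k * (g k h + -1 * l k)).
  assert (HF : right_lim (fun h => sum_n (fun k => u k h) N) 0).
  { replace 0 with (sum_n (fun k => a k * (l k + -1 * l k)) N).
    - apply filterlim_sum_n. intros k. unfold u.
      apply filterlim_mult_const, filterlim_add; [apply Hl | apply filterlim_const].
    - rewrite (sum_n_ext _ (fun _ => 0)), sum_n_const; [apply Rmult_0_r|].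
      intros k. replace (l k + -1 * l k) with 0 by ring. apply Rmult_0_r. }
  destruct (proj1 (right_lim_eps _ _) HF (eps / 2)) as (d & d0 & Hd); [lra|].
  exists d; split; [exact d0|]. intros h Hh. specialize (Hd h Hh).
  rewrite Rminus_0_r in Hd.
  pose proof (is_series_sub _ _ _ _ (HT h ltac:(lra)) HL) as HD.
  (* the tail of [a] beyond the index [N] *)
  set (r := fun k => if (k <=? N)%nat then 0 else a k).
  assert (Hr : is_series r (A - sum_n a N)).
  { eapply is_series_ext; [|apply (is_series_sub _ _ _ _ HA (is_series_truncate a N))].
    intros k. unfold r. simpl. destruct (k <=? N)%nat; lra. }
  assert (Hru : is_series (fun k => r k * (g k h + -1 * l k)) ((T h - L) - sum_n (fun k => u k h) N)).
  { eapply is_series_ext; [|apply (is_series_sub _ _ _ _ HD (is_series_truncate (fun k => u k h) N))].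
    intros k. unfold r, u. simpl. destruct (k <=? N)%nat; ring. }
  apply is_series_bounded_mult with (M := 2 * M) (l := A - sum_n a N) in Hru.
  - assert (HA2 : A - sum_n a N < eps / (4 * (M + 1))).
    { apply Rabs_def2 in HN. lra. }
    assert (2 * M * (A - sum_n a N) <= eps / 2).
    { apply Rle_trans with (2 * M * (eps / (4 * (M + 1)))).
      - apply Rmult_le_compat_l; lra.
      - apply Rmult_le_reg_r with (4 * (M + 1)); [lra|]. field_simplify; nra. }
    replace (T h - L) with ((T h - L - sum_n (fun k => u k h) N) + sum_n (fun k => u k h) N) by ring.
    eapply Rle_lt_trans; [apply Rabs_triang|]. lra.
  - intros k. unfold r. destruct (k <=? N)%nat; [lra|apply Ha].
  - intros k. eapply Rle_trans; [apply Rabs_triang|].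
    rewrite Rabs_mult. replace (Rabs (-1)) with 1 by (rewrite Rabs_left; lra).
    specialize (Hg k h ltac:(lra)). specialize (Hlb k). lra.
  - exact Hr.
Qed.

(** * Right derivatives *)

(** One-sided because the Chapman-Kolmogorov equations only give the quotients
    with a positive increment directly. *)
Definition right_derive (f : R -> R) (t l : R) : Prop :=
  right_lim (fun h => (f (t + h) - f t) / h) l.

(** At the last time where [f t - f 0 <= eps * t] holds, the vanishing right
    derivative would let the inequality persist a little longer. *)
Lemma right_derive_growth_le (f : R -> R) (eps T : R) :
  (forall t, continuous f t) -> 0 < eps ->
  (forall t, 0 <= t -> right_derive f t 0) -> 0 <= T -> f T - f 0 <= eps * T.
Proof.
  intros Hc He Hd HT.
  destruct (Rle_lt_dec (f T - f 0) (eps * T)) as [|C]; [assumption|exfalso].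
  set (E := fun t => 0 <= t <= T /\ f t - f 0 <= eps * t).
  destruct (completeness E) as [s [Hs1 Hs2]].
  - exists T. intros t [Ht _]. lra.
  - exists 0. split; lra.
  - assert (s0 : 0 <= s) by (apply Hs1; split; lra).
    assert (sT : s <= T) by (apply Hs2; intros t [Ht _]; lra).
    (* the supremum is attained, by continuity of [f] from the left *)
    assert (Es : f s - f 0 <= eps * s).
    { destruct (Rle_lt_dec (f s - f 0) (eps * s)) as [|C']; [assumption|exfalso].
      assert (Hg : continuous (fun t => f t - f 0 - eps * t) s).
      { apply (continuous_minus (V := R_NormedModule)).
        - apply (continuous_minus (V := R_NormedModule)); [apply Hc | apply continuous_const].
        - apply (continuous_mult (K := R_AbsRing)); [apply continuous_const | apply continuous_id]. }
      apply filterlim_locally with (eps := mkposreal (f s - f 0 - eps * s) ltac:(lra)) in Hg.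
      destruct Hg as [d Hg]. pose proof (cond_pos d).
      assert (K : s <= s - d / 2).
      { apply Hs2. intros t Ht. destruct (Rle_lt_dec t (s - d / 2)) as [|L]; [assumption|exfalso].
        pose proof (Hs1 t Ht). destruct Ht as [Ht1 Ht2].
        specialize (Hg t).
        assert (B : ball s d t) by (change (Rabs (t - s) < d); apply Rabs_def1; lra).
        specialize (Hg B).
        change (Rabs (f t - f 0 - eps * t - (f s - f 0 - eps * s)) < f s - f 0 - eps * s) in Hg.
        apply Rabs_def2 in Hg. lra. }
      lra. }
    destruct (Req_dec s T) as [->|Hne]; [lra|].
    specialize (Hd s s0). unfold right_derive in Hd. rewrite right_lim_eps in Hd.
    destruct (Hd eps He) as (d & d0 & H).
    set (h := Rmin (d / 2) (T - s)).
    assert (Hh : 0 < h < d /\ h <= T - s).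
    { unfold h, Rmin. destruct (Rle_dec (d / 2) (T - s)); lra. }
    destruct Hh as [Hh HhT]. specialize (H h Hh). apply Rabs_def2 in H.
    assert (f (s + h) - f s <= eps * h).
    { replace (f (s + h) - f s) with ((f (s + h) - f s) / h * h) by (field; lra).
      apply Rmult_le_compat_r; lra. }
    assert (s + h <= s) by (apply Hs1; split; lra). lra.
Qed.

Lemma right_derive_0_const (f : R -> R) (T : R) :
  (forall t, continuous f t) ->
  (forall t, 0 <= t -> right_derive f t 0) -> 0 <= T -> f T = f 0.
Proof.
  intros Hc Hd HT.
  assert (Hd' : forall t, 0 <= t -> right_derive (fun t => - f t) t 0).
  { intros t Ht. unfold right_derive.
    apply right_lim_ext with (fun h => -1 * ((f (t + h) - f t) / h)).
    - intros h h0. field. lra.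
    - replace 0 with (-1 * 0) by ring. apply filterlim_mult_const, Hd, Ht. }
  assert (Hc' : forall t, continuous (fun t => - f t) t).
  { intros t. apply (continuous_opp (V := R_NormedModule)), Hc. }
  assert (H : Rabs (f T - f 0) <= 0).
  { apply le_epsilon. intros eps He.
    assert (P : 0 < eps / (T + 1)) by (apply Rdiv_lt_0_compat; lra).
    pose proof (right_derive_growth_le f _ T Hc P Hd HT).
    pose proof (right_derive_growth_le _ _ T Hc' P Hd' HT).
    assert (eps / (T + 1) * T <= eps).
    { apply Rmult_le_reg_r with (T + 1); [lra|]. field_simplify; nra. }
    apply Rabs_le; lra. }
  pose proof (Rabs_pos (f T - f 0)).
  destruct (Req_dec (f T - f 0) 0) as [|N]; [lra|].
  apply Rabs_no_R0 in N. lra.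
Qed.

Lemma is_derive_right_derive (f : R -> R) (t l : R) :
  is_derive f t l -> right_derive f t l.
Proof.
  intros H. apply is_derive_Reals in H. apply right_lim_eps. intros eps He.
  destruct (H eps He) as [d Hd]. exists d. split; [apply cond_pos|].
  intros h [h0 hd]. apply Hd; [lra|]. rewrite Rabs_pos_eq; lra.
Qed.

Lemma is_RInt_of_continuous (f : R -> R) (a b : R) :
  (forall t, continuous f t) -> is_RInt f a b (RInt f a b).
Proof.
  intros H. apply (RInt_correct (V := R_CompleteNormedModule)).
  apply (ex_RInt_continuous (V := R_CompleteNormedModule)). intros; apply H.
Qed.

(** Fundamental theorem of calculus for a merely right-differentiable [f]:
    subtracting the integral of [g] leaves a continuous function whose right
    derivative vanishes. *)
Lemma RInt_right_derive (f g : R -> R) (T : R) :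
  (forall t, continuous f t) -> (forall t, continuous g t) ->
  (forall t, 0 <= t -> right_derive f t (g t)) -> 0 <= T ->
  f T = f 0 + RInt g 0 T.
Proof.
  intros Hf Hg Hd HT.
  assert (HI : forall t, is_derive (fun t => RInt g 0 t) t (g t)).
  { intros t. apply (is_derive_RInt (V := R_NormedModule)) with 0; [|apply Hg].
    apply filter_forall. intros x. apply (RInt_correct (V := R_CompleteNormedModule)).
    apply (ex_RInt_continuous (V := R_CompleteNormedModule)). intros; apply Hg. }
  assert (E : f T - RInt g 0 T = f 0 - RInt g 0 0).
  { apply (right_derive_0_const (fun t => f t - RInt g 0 t)); [| |exact HT].
    - intros t. apply (continuous_minus (V := R_NormedModule)); [apply Hf|].
      apply (ex_derive_continuous (V := R_NormedModule)). eexists; apply HI.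
    - intros t Ht. unfold right_derive.
      apply right_lim_ext with
        (fun h => (f (t + h) - f t) / h + -1 * ((RInt g 0 (t + h) - RInt g 0 t) / h)).
      + intros h h0. field. lra.
      + apply (eq_ind (g t + -1 * g t) (right_lim _)); [|ring].
        apply filterlim_add; [apply Hd, Ht|]. apply filterlim_mult_const.
        exact (is_derive_right_derive (fun t => RInt g 0 t) t (g t) (HI t)). }
  rewrite RInt_point in E. change (zero (G := R_CompleteNormedModule)) with 0 in E. lra.
Qed.

(** * Transition functions with uniformly bounded escape rates *)

Lemma tf_row_is_series (p : nat -> nat -> R -> R) (i : nat) (t : R) :
  transition_function p -> 0 <= t ->
  exists r, r <= 1 /\ is_series (fun j => p i j t) r.
Proof.
  intros Hp Ht. destruct (tf_row p Hp i t Ht) as [He Hs].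
  eexists; split; [exact Hs|]. now apply Series_correct.
Qed.

Lemma tf_le1 (p : nat -> nat -> R -> R) (i j : nat) (t : R) :
  transition_function p -> 0 <= t -> p i j t <= 1.
Proof.
  intros Hp Ht. destruct (tf_row_is_series p i t Hp Ht) as (r & Hr & Hs).
  apply Rle_trans with r; [|exact Hr].
  apply (is_series_term_le (fun j => p i j t)); [|exact Hs].
  intros k. now apply (tf_ge0 p Hp).
Qed.

(** Staying in [i] at each of [n] successive times is one way of being in [i]
    at the last one. *)
Lemma tf_diag_pow (p : nat -> nat -> R -> R) (i n : nat) (h : R) :
  transition_function p -> 0 <= h -> p i i h ^ n <= p i i (INR n * h).
Proof.
  intros Hp Hh. induction n as [|n IH].
  - replace (INR 0 * h) with 0 by (simpl; ring).
    rewrite (tf_init p Hp). unfold kron. rewrite Nat.eqb_refl. simpl; lra.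
  - assert (H0 : 0 <= INR n * h) by (apply Rmult_le_pos; [apply pos_INR|lra]).
    replace (INR (S n) * h) with (h + INR n * h) by (rewrite S_INR; ring).
    apply Rle_trans with (p i i h * p i i (INR n * h)).
    + simpl. apply Rmult_le_compat_l; [now apply (tf_ge0 p Hp)|exact IH].
    + apply (is_series_term_le (fun k => p i k h * p k i (INR n * h)));
        [|now apply (tf_CK p Hp)].
      intros k. apply Rmult_le_pos; now apply (tf_ge0 p Hp).
Qed.

Lemma bernoulli_le (x : R) (n : nat) : 0 <= x <= 1 -> 1 - INR n * (1 - x) <= x ^ n.
Proof.
  intros Hx. induction n as [|n IH]; [simpl; lra|].
  rewrite S_INR. simpl.
  assert (0 <= INR n) by apply pos_INR.
  assert (x * (1 - INR n * (1 - x)) <= x * x ^ n) by (apply Rmult_le_compat_l; lra).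
  assert (0 <= INR n * ((1 - x) * (1 - x))).
  { apply Rmult_le_pos; [assumption|]. apply Rmult_le_pos; lra. }
  nra.
Qed.

(** Cut [[0, t]] into [n] equal steps. Bernoulli's inequality turns
    [p i i t >= p i i (t / n) ^ n] into
    [p i i t >= 1 + t * ((p i i h - 1) / h)] with [h = t / n], and the quotient
    tends to the diagonal rate. *)
Lemma tf_diag_lower (p : nat -> nat -> R -> R) (i : nat) (qi t : R) :
  transition_function p -> right_derive (p i i) 0 qi -> 0 <= t ->
  1 + qi * t <= p i i t.
Proof.
  intros Hp Hq Ht.
  assert (Hinit : p i i 0 = 1).
  { rewrite (tf_init p Hp). unfold kron. now rewrite Nat.eqb_refl. }
  destruct (Req_dec t 0) as [->|Hne]; [rewrite Hinit; lra|].
  apply le_epsilon. intros eps He.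
  assert (P : 0 < eps / t) by (apply Rdiv_lt_0_compat; lra).
  destruct (proj1 (right_lim_eps _ _) Hq _ P) as (d & d0 & Hd).
  destruct (archimed_cor1 (d / t)) as (n & Hn & n0); [apply Rdiv_lt_0_compat; lra|].
  assert (N0 : 0 < INR n) by now apply lt_0_INR.
  set (h := t / INR n).
  assert (Hh : 0 < h) by (apply Rdiv_lt_0_compat; lra).
  assert (Hhd : h < d).
  { unfold h, Rdiv. apply Rmult_lt_compat_l with (r := t) in Hn; [|lra].
    replace (t * (d / t)) with d in Hn by (field; lra). exact Hn. }
  specialize (Hd h (conj Hh Hhd)). rewrite Rplus_0_l, Hinit in Hd.
  apply Rabs_def2 in Hd. destruct Hd as [_ Hd].
  pose proof (tf_diag_pow p i n h Hp ltac:(lra)) as Hpow.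
  pose proof (bernoulli_le (p i i h) n) as HB.
  replace (INR n * h) with t in Hpow by (unfold h; field; lra).
  assert (0 <= p i i h <= 1).
  { split; [apply (tf_ge0 p Hp); lra | apply tf_le1; [exact Hp|lra]]. }
  specialize (HB H).
  replace (INR n * (1 - p i i h)) with (- (t * ((p i i h - 1) / h))) in HB
    by (unfold h; field; lra).
  assert (t * (qi - eps / t) <= t * ((p i i h - 1) / h)) by (apply Rmult_le_compat_l; lra).
  replace (t * (qi - eps / t)) with (qi * t - eps) in H0 by (field; lra).
  lra.
Qed.

(** This is how boundedness of the q-matrix enters: the probability of having
    left a state is at most linear in time, uniformly in the state. *)
Definition linear_escape (p : nat -> nat -> R -> R) (M : R) : Prop :=
  forall k h, 0 <= h -> 1 - p k k h <= M * h.

(** Off the diagonal [p k j h] is part of the mass [1 - p k k h] that left [k]. *)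
Lemma tf_dist_kron (p : nat -> nat -> R -> R) (M : R) (k j : nat) (h : R) :
  transition_function p -> linear_escape p M -> 0 <= h ->
  Rabs (p k j h - kron k j) <= M * h.
Proof.
  intros Hp HM Hh. pose proof (HM k h Hh).
  pose proof (tf_le1 p k j h Hp Hh). pose proof (tf_ge0 p Hp k j h Hh).
  unfold kron. destruct (Nat.eqb_spec k j) as [->|Hkj].
  - apply Rabs_le; lra.
  - destruct (tf_row_is_series p k h Hp Hh) as (r & Hr & Hs).
    apply (is_series_two_terms_le _ _ k j Hkj) in Hs;
      [|intros l; now apply (tf_ge0 p Hp)].
    apply Rabs_le; lra.
Qed.

(** Chapman-Kolmogorov, with [p i j t] written as the series of
    [p i k t * kron k j]. *)
Lemma tf_increment (p : nat -> nat -> R -> R) (i j : nat) (t h : R) :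
  transition_function p -> 0 <= t -> 0 <= h ->
  is_series (fun k => p i k t * (p k j h - kron k j)) (p i j (t + h) - p i j t).
Proof.
  intros Hp Ht Hh.
  eapply is_series_ext;
    [|apply (is_series_sub _ _ _ _ (tf_CK p Hp i j t h Ht Hh)
               (is_series_kron (fun k => p i k t) j))].
  intros k. simpl. ring.
Qed.

Lemma tf_lipschitz (p : nat -> nat -> R -> R) (M : R) (i j : nat) (t h : R) :
  transition_function p -> linear_escape p M -> 0 <= t -> 0 <= h ->
  Rabs (p i j (t + h) - p i j t) <= M * h.
Proof.
  intros Hp HM Ht Hh.
  destruct (tf_row_is_series p i t Hp Ht) as (r & Hr & Hs).
  assert (H : Rabs (p i j (t + h) - p i j t) <= M * h * r).
  { refine (is_series_bounded_mult _ _ _ _ _ _ _ Hs (tf_increment p i j t h Hp Ht Hh)).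
    - intros k. now apply (tf_ge0 p Hp).
    - intros k. now apply tf_dist_kron. }
  assert (0 <= M * h).
  { eapply Rle_trans; [apply Rabs_pos|]. now apply (tf_dist_kron p M i j h). }
  nra.
Qed.

(** Transition functions are only controlled at nonnegative times; freezing the
    value at time [0] for negative times gives functions continuous everywhere. *)
Definition extend (f : R -> R) (t : R) : R := f (Rmax 0 t).

Lemma extend_pos (f : R -> R) (t : R) : 0 <= t -> extend f t = f t.
Proof. intros Ht. unfold extend. now rewrite Rmax_right. Qed.

Lemma extend_continuous (f : R -> R) (M t : R) :
  (forall s h, 0 <= s -> 0 <= h -> Rabs (f (s + h) - f s) <= M * h) ->
  continuous (extend f) t.
Proof.
  intros H.
  assert (HL : forall x y, Rabs (extend f x - extend f y) <= Rabs M * Rabs (x - y)).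
  { assert (HL0 : forall x y, y <= x -> Rabs (extend f x - extend f y) <= Rabs M * Rabs (x - y)).
    { intros x y Hxy. unfold extend.
      set (s := Rmax 0 y). set (h := Rmax 0 x - s).
      assert (Hsh : 0 <= s /\ 0 <= h <= x - y).
      { unfold h, s, Rmax. destruct (Rle_dec 0 y), (Rle_dec 0 x); lra. }
      replace (Rmax 0 x) with (s + h) by (unfold h; ring).
      apply Rle_trans with (M * h); [apply H; tauto|].
      rewrite (Rabs_pos_eq (x - y)) by lra. pose proof (Rle_abs M).
      assert (M * h <= Rabs M * h) by (apply Rmult_le_compat_r; lra).
      assert (Rabs M * h <= Rabs M * (x - y))
        by (apply Rmult_le_compat_l; [apply Rabs_pos|lra]). lra. }
    intros x y. destruct (Rle_lt_dec y x); [now apply HL0|].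
    rewrite Rabs_minus_sym, (Rabs_minus_sym x). apply HL0; lra. }
  apply filterlim_locally. intros eps.
  assert (A0 := Rabs_pos M).
  assert (P : 0 < eps / (Rabs M + 1)) by (apply Rdiv_lt_0_compat; [apply cond_pos|lra]).
  exists (mkposreal _ P). intros x Hx. change (Rabs (x - t) < eps / (Rabs M + 1)) in Hx.
  change (Rabs (extend f x - extend f t) < eps).
  eapply Rle_lt_trans; [apply HL|].
  pose proof (cond_pos eps). pose proof (Rabs_pos (x - t)).
  apply Rle_lt_trans with ((Rabs M + 1) * Rabs (x - t)); [nra|].
  apply Rmult_lt_compat_l with (r := Rabs M + 1) in Hx; [|lra].
  replace ((Rabs M + 1) * (eps / (Rabs M + 1))) with (pos eps) in Hx by (field; lra).
  exact Hx.
Qed.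

Lemma extend_tf_continuous (p : nat -> nat -> R -> R) (M : R) (i k : nat) (t : R) :
  transition_function p -> linear_escape p M -> continuous (extend (p i k)) t.
Proof.
  intros Hp HM. apply extend_continuous with M.
  intros s h Hs Hh. now apply tf_lipschitz.
Qed.

Lemma continuous_sum_n (f : nat -> R -> R) (N : nat) (t : R) :
  (forall k, continuous (f k) t) -> continuous (fun t => sum_n (fun k => f k t) N) t.
Proof.
  intros H. induction N as [|N IH].
  - apply continuous_ext with (f 0%nat); [intros x; now rewrite sum_O|apply H].
  - apply continuous_ext with (fun t => plus (sum_n (fun k => f k t) N) (f (S N) t));
      [intros x; now rewrite sum_Sn|].
    apply (continuous_plus (V := R_NormedModule)); [exact IH|apply H].
Qed.

(** Forward equation. The quotients [(p k j h - kron k j) / h] are bounded by [M]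
    uniformly in [k], so Tannery's theorem lets the limit pass under the
    Chapman-Kolmogorov series. A column of the q-matrix with finite support turns
    the limit into a finite sum, which is continuous in [t]. *)
Lemma tf_right_derive (p : nat -> nat -> R -> R) (q : nat -> nat -> R)
  (M : R) (i j N : nat) (t : R) :
  transition_function p -> has_q_matrix p q -> linear_escape p M ->
  (forall k, (N < k)%nat -> q k j = 0) -> 0 <= t ->
  right_derive (p i j) t (sum_n (fun k => p i k t * q k j) N).
Proof.
  intros Hp Hq HM HN Ht. unfold right_derive.
  destruct (tf_row_is_series p i t Hp Ht) as (r & Hr & Hs).
  apply (tannery (fun k => p i k t) (fun k h => (p k j h - p k j 0) / h)
           (fun k => q k j) _ M).
  - intros k. now apply (tf_ge0 p Hp).
  - now exists r.
  - intros k h h0. rewrite (tf_init p Hp).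
    unfold Rdiv. rewrite Rabs_mult, (Rabs_pos_eq (/ h)) by (left; now apply Rinv_0_lt_compat).
    apply Rmult_le_reg_r with h; [exact h0|].
    replace (Rabs (p k j h - kron k j) * / h * h) with (Rabs (p k j h - kron k j))
      by (field; lra).
    apply tf_dist_kron; [exact Hp|exact HM|lra].
  - intros k. apply Hq.
  - intros h h0.
    pose proof (tf_increment p i j t h Hp Ht ltac:(lra)) as H.
    apply (is_series_mult_const_l (/ h)) in H.
    replace ((p i j (t + h) - p i j t) / h) with (/ h * (p i j (t + h) - p i j t))
      by (unfold Rdiv; ring).
    eapply is_series_ext; [|exact H]. intros k. simpl.
    rewrite (tf_init p Hp). unfold Rdiv. ring.
  - apply is_series_finite. intros k Hk. cbv beta. rewrite HN by exact Hk.
    apply Rmult_0_r.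
Qed.

Lemma tf_forward_integral (p : nat -> nat -> R -> R) (q : nat -> nat -> R)
  (M : R) (i j N : nat) (T : R) :
  transition_function p -> has_q_matrix p q -> linear_escape p M ->
  (forall k, (N < k)%nat -> q k j = 0) -> 0 <= T ->
  extend (p i j) T = kron i j
    + RInt (fun t => sum_n (fun k => extend (p i k) t * q k j) N) 0 T.
Proof.
  intros Hp Hq HM HN HT.
  assert (HC : forall k t, continuous (extend (p i k)) t).
  { intros k t. apply extend_continuous with M. intros s h Hs Hh. now apply tf_lipschitz. }
  rewrite (RInt_right_derive (extend (p i j))
             (fun t => sum_n (fun k => extend (p i k) t * q k j) N) T).
  - rewrite (extend_pos (p i j) 0), (tf_init p Hp) by lra. reflexivity.
  - apply HC.
  - intros t. apply continuous_sum_n. intros k.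
    apply (continuous_mult (K := R_AbsRing)); [apply HC|apply continuous_const].
  - intros t Ht. unfold right_derive.
    apply right_lim_ext with (fun h => (p i j (t + h) - p i j t) / h).
    + intros h h0. now rewrite !extend_pos by lra.
    + rewrite (sum_n_ext _ (fun k => p i k t * q k j)).
      * now apply tf_right_derive with M.
      * intros k. now rewrite extend_pos.
  - exact HT.
Qed.

(** * Laplace transforms *)

(** The integrals over [[0, T]] of a nonnegative function increase with [T], so a
    bound makes them converge. Later [f] is the integrand of the resolvent and [g] its
    continuous extension to the whole line. *)
Lemma filterlim_RInt_gen (f g : R -> R) (M : R) :
  (forall t, 0 < t -> f t = g t) ->
  (forall t, continuous g t) -> (forall t, 0 <= t -> 0 <= g t) ->
  (forall T, 0 <= T -> RInt g 0 T <= M) ->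
  filterlim (fun T => RInt g 0 T) (Rbar_locally p_infty)
    (locally (RInt_gen f (at_point 0) (Rbar_locally p_infty))).
Proof.
  intros Hfg Hc H0 HM.
  assert (Hex : forall a b, ex_RInt g a b).
  { intros a b. apply (ex_RInt_continuous (V := R_CompleteNormedModule)). intros; apply Hc. }
  assert (Hmono : forall a b, 0 <= a <= b -> RInt g 0 a <= RInt g 0 b).
  { intros a b Hab.
    rewrite <- (RInt_Chasles (V := R_CompleteNormedModule) g 0 a b) by apply Hex.
    change (RInt g 0 a <= RInt g 0 a + RInt g a b).
    assert (0 <= RInt g a b); [|lra].
    apply RInt_ge_0; [lra|apply Hex|]. intros; apply H0; lra. }
  destruct (completeness (fun x => exists T, 0 <= T /\ x = RInt g 0 T)) as [l [L1 L2]].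
  - exists M. intros x (T & HT & ->). now apply HM.
  - exists (RInt g 0 0), 0. split; [lra|reflexivity].
  - assert (Hl : filterlim (fun T => RInt g 0 T) (Rbar_locally p_infty) (locally l)).
    { apply filterlim_locally. intros eps.
      destruct (classic (exists T, 0 <= T /\ l - eps < RInt g 0 T)) as [(T & HT & HTl)|N].
      - exists T. intros x Hx.
        pose proof (Hmono T x ltac:(lra)).
        assert (RInt g 0 x <= l) by (apply L1; exists x; split; [lra|reflexivity]).
        pose proof (cond_pos eps).
        change (Rabs (RInt g 0 x - l) < eps). apply Rabs_def1; lra.
      - exfalso. assert (l <= l - eps).
        { apply L2. intros x (T & HT & ->).
          destruct (Rle_lt_dec (RInt g 0 T) (l - eps)); [assumption|].
          exfalso; apply N; eauto. }
        pose proof (cond_pos eps). lra. }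
    replace (RInt_gen f (at_point 0) (Rbar_locally p_infty)) with l; [exact Hl|].
    symmetry. apply (is_RInt_gen_unique (V := R_CompleteNormedModule)).
    apply (filterlimi_lim_ext_loc (F := filter_prod (at_point 0) (Rbar_locally p_infty))
             (fun ab => RInt g (fst ab) (snd ab))).
    + exists (fun x => x = 0) (fun y => 0 < y); [reflexivity|now exists 0|].
      intros x y -> Hy. simpl. apply (is_RInt_ext g).
      * intros t. rewrite Rmin_left by lra. intros Ht. symmetry. apply Hfg, Ht.
      * apply (RInt_correct (V := R_CompleteNormedModule)), Hex.
    + intros P HP. specialize (Hl P HP).
      exists (fun x => x = 0) (fun y => P (RInt g 0 y)); [reflexivity|exact Hl|].
      intros x y -> Hy. exact Hy.
Qed.

Lemma filterlim_p_infty_le (f g : R -> R) (lf lg : R) :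
  (forall T, 0 <= T -> f T <= g T) ->
  filterlim f (Rbar_locally p_infty) (locally lf) ->
  filterlim g (Rbar_locally p_infty) (locally lg) -> lf <= lg.
Proof.
  intros H Hf Hg.
  refine (filterlim_le (F := Rbar_locally p_infty) f g lf lg _ Hf Hg).
  exists 0. intros T HT. apply H; lra.
Qed.

Definition truncated_laplace (lambda : R) (f : R -> R) (T : R) : R :=
  RInt (fun t => exp (- lambda * t) * f t) 0 T.

Lemma is_derive_exp_scal (lambda t : R) :
  is_derive (fun t => exp (- lambda * t)) t (- lambda * exp (- lambda * t)).
Proof. auto_derive; [exact I|ring]. Qed.

Lemma continuous_exp_mult (lambda : R) (f : R -> R) (t : R) :
  continuous f t -> continuous (fun t => exp (- lambda * t) * f t) t.
Proof.
  intros H. apply (continuous_mult (K := R_AbsRing)); [|exact H].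
  apply (ex_derive_continuous (V := R_NormedModule)).
  eexists; apply is_derive_exp_scal.
Qed.

Lemma truncated_laplace_correct (lambda T : R) (f : R -> R) :
  (forall t, continuous f t) ->
  is_RInt (fun t => exp (- lambda * t) * f t) 0 T (truncated_laplace lambda f T).
Proof.
  intros H. apply is_RInt_of_continuous. intros t. apply continuous_exp_mult, H.
Qed.

Lemma is_RInt_sum_n (f : nat -> R -> R) (l : nat -> R) (a b : R) (N : nat) :
  (forall k, is_RInt (f k) a b (l k)) ->
  is_RInt (fun t => sum_n (fun k => f k t) N) a b (sum_n l N).
Proof.
  intros H. induction N as [|N IH].
  - rewrite sum_O. apply is_RInt_ext with (f 0%nat); [|apply H].
    intros t _. now rewrite sum_O.
  - rewrite sum_Sn.
    apply is_RInt_ext with (fun t => plus (sum_n (fun k => f k t) N) (f (S N) t)).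
    + intros t _. now rewrite sum_Sn.
    + apply (is_RInt_plus (V := R_NormedModule)); [exact IH|apply H].
Qed.

Lemma truncated_laplace_sum_n (lambda T : R) (f : nat -> R -> R) (c : nat -> R) (N : nat) :
  (forall k t, continuous (f k) t) ->
  truncated_laplace lambda (fun t => sum_n (fun k => f k t * c k) N) T
  = sum_n (fun k => truncated_laplace lambda (f k) T * c k) N.
Proof.
  intros H. apply (is_RInt_unique (V := R_CompleteNormedModule)).
  apply is_RInt_ext with
    (fun t => sum_n (fun k => scal (c k) (exp (- lambda * t) * f k t)) N).
  - intros t _. rewrite <- sum_n_mult_const. apply sum_n_ext. intros k.
    change (c k * (exp (- lambda * t) * f k t) = exp (- lambda * t) * (f k t * c k)). ring.
  - apply is_RInt_sum_n. intros k. rewrite Rmult_comm.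
    apply (is_RInt_scal (V := R_NormedModule)), truncated_laplace_correct, H.
Qed.

(** Integration by parts, applied to [f 0 + RInt g 0 t]: it agrees with [f] on
    [[0, T]] and is differentiable on the whole line. *)
Lemma truncated_laplace_by_parts (lambda T : R) (f g : R -> R) :
  (forall t, continuous f t) -> (forall t, continuous g t) ->
  (forall t, 0 <= t -> f t = f 0 + RInt g 0 t) -> 0 <= T ->
  exp (- lambda * T) * f T - f 0
  = truncated_laplace lambda g T - lambda * truncated_laplace lambda f T.
Proof.
  intros Hf Hg HI HT.
  set (F := fun t => f 0 + RInt g 0 t).
  assert (HF : forall t, is_derive F t (g t)).
  { intros t. unfold F.
    evar_last.
    - apply (is_derive_plus (V := R_NormedModule)); [apply is_derive_const|].
      apply (is_derive_RInt (V := R_NormedModule)) with 0; [|apply Hg].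
      apply filter_forall. intros x. now apply is_RInt_of_continuous.
    - apply (plus_zero_l (G := R_AbelianGroup)). }
  set (D := fun t => exp (- lambda * t) * g t - lambda * (exp (- lambda * t) * F t)).
  assert (HFc : forall t, continuous F t).
  { intros t. apply (ex_derive_continuous (V := R_NormedModule)). eexists; apply HF. }
  assert (H1 : is_RInt D 0 T (exp (- lambda * T) * F T - exp (- lambda * 0) * F 0)).
  { apply (is_RInt_derive (V := R_CompleteNormedModule)
             (fun t => exp (- lambda * t) * F t)).
    - intros t _. evar_last.
      + apply (is_derive_mult (K := R_AbsRing)
                 (fun t => exp (- lambda * t)) F t);
          [apply is_derive_exp_scal | apply HF | intros; apply Rmult_comm].
      + unfold D, plus, mult; simpl. ring.
    - intros t _. apply (continuous_minus (V := R_NormedModule)).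
      + apply continuous_exp_mult, Hg.
      + apply (continuous_mult (K := R_AbsRing)); [apply continuous_const|].
        apply continuous_exp_mult, HFc. }
  assert (H2 : is_RInt D 0 T
                 (truncated_laplace lambda g T - lambda * truncated_laplace lambda f T)).
  { apply is_RInt_ext with
      (fun t => minus (exp (- lambda * t) * g t) (scal lambda (exp (- lambda * t) * f t))).
    - intros t. rewrite Rmin_left by exact HT. intros [Ht _].
      unfold D, F. rewrite <- HI by lra. reflexivity.
    - apply (is_RInt_minus (V := R_NormedModule)); [|apply (is_RInt_scal (V := R_NormedModule))];
        now apply truncated_laplace_correct. }
  apply (is_RInt_unique (V := R_CompleteNormedModule)) in H1.
  apply (is_RInt_unique (V := R_CompleteNormedModule)) in H2.
  assert (HF0 : F 0 = f 0) by (unfold F; now rewrite <- HI by lra).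
  rewrite Rmult_0_r, exp_0, HF0, Rmult_1_l in H1.
  unfold F in H1. rewrite <- HI in H1 by exact HT.
  now rewrite <- H1, <- H2.
Qed.

Lemma truncated_laplace_one_le (lambda T : R) :
  0 < lambda -> truncated_laplace lambda (fun _ => 1) T <= 1 / lambda.
Proof.
  intros Hl.
  assert (H : is_RInt (fun t => exp (- lambda * t) * 1) 0 T
                (- / lambda * exp (- lambda * T) - - / lambda * exp (- lambda * 0))).
  { apply (is_RInt_derive (V := R_CompleteNormedModule)
             (fun t => - / lambda * exp (- lambda * t))).
    - intros t _. auto_derive; [exact I|]. field. lra.
    - intros t _. apply continuous_exp_mult, continuous_const. }
  unfold truncated_laplace.
  rewrite (is_RInt_unique (V := R_CompleteNormedModule) _ _ _ _ H).
  rewrite Rmult_0_r, exp_0.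
  pose proof (exp_pos (- lambda * T)). pose proof (Rinv_0_lt_compat _ Hl).
  unfold Rdiv. nra.
Qed.

Lemma exp_scal_lim_0 (lambda : R) :
  0 < lambda ->
  filterlim (fun T => exp (- lambda * T)) (Rbar_locally p_infty) (locally 0).
Proof.
  intros Hl. apply filterlim_locally. intros eps.
  exists (- ln eps / lambda). intros T HT.
  change (Rabs (exp (- lambda * T) - 0) < eps).
  rewrite Rminus_0_r, Rabs_pos_eq by (left; apply exp_pos).
  rewrite <- (exp_ln eps) by apply cond_pos. apply exp_increasing.
  apply Rmult_lt_compat_l with (r := lambda) in HT; [|exact Hl].
  replace (lambda * (- ln eps / lambda)) with (- ln eps) in HT by (field; lra). lra.
Qed.

(** * The forward equation of the resolvent *)

(** Row sums at most [1] bound the integrand by [exp (- lambda * t)]. *)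
Lemma truncated_laplace_row_le (p : nat -> nat -> R -> R) (M lambda T : R) (i N : nat) :
  transition_function p -> linear_escape p M -> 0 < lambda -> 0 <= T ->
  sum_n (fun k => truncated_laplace lambda (extend (p i k)) T) N <= 1 / lambda.
Proof.
  intros Hp HM Hl HT.
  assert (HC := extend_tf_continuous p M).
  rewrite (sum_n_ext _ (fun k => truncated_laplace lambda (extend (p i k)) T * 1))
    by (intros; symmetry; apply Rmult_1_r).
  rewrite <- truncated_laplace_sum_n by auto.
  eapply Rle_trans; [|apply (truncated_laplace_one_le lambda T Hl)].
  apply RInt_le; [exact HT| | |].
  - eexists. apply truncated_laplace_correct. intros t.
    apply continuous_sum_n. intros k.
    apply (continuous_mult (K := R_AbsRing)); [auto|apply continuous_const].
  - eexists. apply truncated_laplace_correct. intros t. apply continuous_const.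
  - intros t Ht. apply Rmult_le_compat_l; [left; apply exp_pos|].
    destruct (tf_row_is_series p i t Hp ltac:(lra)) as (r & Hr & Hs).
    apply Rle_trans with r; [|exact Hr].
    rewrite (sum_n_ext _ (fun k => p i k t)).
    + apply sum_n_le_is_series; [|exact Hs]. intros k. apply (tf_ge0 p Hp). lra.
    + intros k. rewrite extend_pos by lra. apply Rmult_1_r.
Qed.

Lemma truncated_laplace_ge0 (p : nat -> nat -> R -> R) (M lambda T : R) (i k : nat) :
  transition_function p -> linear_escape p M -> 0 <= T ->
  0 <= truncated_laplace lambda (extend (p i k)) T.
Proof.
  intros Hp HM HT. apply RInt_ge_0; [exact HT| |].
  - eexists. apply truncated_laplace_correct. intros t. now apply extend_tf_continuous with M.
  - intros t Ht. rewrite extend_pos by lra.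
    apply Rmult_le_pos; [left; apply exp_pos|apply (tf_ge0 p Hp); lra].
Qed.

(** Gives access to the improper integral: every property of the resolvent below
    is obtained for the integral over [[0, T]] and then passed to the limit. *)
Lemma resolvent_lim (p : nat -> nat -> R -> R) (M lambda : R) (i j : nat) :
  transition_function p -> linear_escape p M -> 0 < lambda ->
  filterlim (truncated_laplace lambda (extend (p i j))) (Rbar_locally p_infty)
    (locally (resolvent p lambda i j)).
Proof.
  intros Hp HM Hl. unfold resolvent.
  apply (filterlim_RInt_gen _ (fun t => exp (- lambda * t) * extend (p i j) t) (1 / lambda)).
  - intros t Ht. now rewrite extend_pos by lra.
  - intros t. now apply continuous_exp_mult, extend_tf_continuous with M.
  - intros t Ht. rewrite extend_pos by exact Ht.
    apply Rmult_le_pos; [left; apply exp_pos|now apply (tf_ge0 p Hp)].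
  - intros T HT.
    apply Rle_trans with (sum_n (fun k => truncated_laplace lambda (extend (p i k)) T) j).
    + destruct j as [|j]; [rewrite sum_O; apply Rle_refl|]. rewrite sum_Sn.
      assert (0 <= sum_n (fun k => truncated_laplace lambda (extend (p i k)) T) j).
      { rewrite <- (Rmult_0_r (INR (S j))), <- (sum_n_const j 0).
        apply sum_n_m_le. intros k. now apply truncated_laplace_ge0 with M. }
      change (truncated_laplace lambda (extend (p i (S j))) T
        <= sum_n (fun k => truncated_laplace lambda (extend (p i k)) T) j
           + truncated_laplace lambda (extend (p i (S j))) T).
      lra.
    + now apply truncated_laplace_row_le with M.
Qed.

Lemma resolvent_ge0 (p : nat -> nat -> R -> R) (M lambda : R) (i j : nat) :
  transition_function p -> linear_escape p M -> 0 < lambda ->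
  0 <= resolvent p lambda i j.
Proof.
  intros Hp HM Hl.
  refine (filterlim_p_infty_le (fun _ => 0) _ _ _ _ (filterlim_const _)
            (resolvent_lim p M lambda i j Hp HM Hl)).
  intros T HT. now apply truncated_laplace_ge0 with M.
Qed.

Lemma ex_series_resolvent (p : nat -> nat -> R -> R) (M lambda : R) (i : nat) :
  transition_function p -> linear_escape p M -> 0 < lambda ->
  ex_series (resolvent p lambda i).
Proof.
  intros Hp HM Hl.
  destruct (ex_finite_lim_seq_incr (sum_n (resolvent p lambda i)) (1 / lambda)) as [l Hlim].
  - intros n. rewrite sum_Sn. pose proof (resolvent_ge0 p M lambda i (S n) Hp HM Hl).
    unfold plus; simpl. lra.
  - intros n.
    refine (filterlim_p_infty_le _ (fun _ => 1 / lambda) _ _ _ _ (filterlim_const _)).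
    2: { apply filterlim_sum_n. intros k. now apply resolvent_lim with M. }
    intros T HT. exact (truncated_laplace_row_le p M lambda T i n Hp HM Hl HT).
  - exists l. exact Hlim.
Qed.

(** Laplace transform of the forward equation; the finite support of column [j]
    lets the integral and the limit act on the sum term by term. *)
Lemma resolvent_forward (p : nat -> nat -> R -> R) (q : nat -> nat -> R)
  (M lambda : R) (i j N : nat) :
  transition_function p -> has_q_matrix p q -> linear_escape p M ->
  (forall k, (N < k)%nat -> q k j = 0) -> 0 < lambda ->
  lambda * resolvent p lambda i j - kron i j
  = sum_n (fun k => resolvent p lambda i k * q k j) N.
Proof.
  intros Hp Hq HM HN Hl.
  assert (HC := fun k t => extend_tf_continuous p M i k t Hp HM).
  assert (Hinit : extend (p i j) 0 = kron i j)
    by (rewrite extend_pos by lra; apply (tf_init p Hp)).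
  set (g := fun t => sum_n (fun k => extend (p i k) t * q k j) N).
  assert (Hg : forall t, continuous g t).
  { intros t. apply continuous_sum_n. intros k.
    apply (continuous_mult (K := R_AbsRing)); [auto|apply continuous_const]. }
  set (lhs := fun T => exp (- lambda * T) * extend (p i j) T
                       + lambda * truncated_laplace lambda (extend (p i j)) T).
  set (rhs := fun T => kron i j
     + sum_n (fun k => truncated_laplace lambda (extend (p i k)) T * q k j) N).
  assert (HE : forall T, 0 <= T -> lhs T = rhs T).
  { intros T HT. unfold lhs, rhs.
    rewrite <- truncated_laplace_sum_n by auto. fold g.
    rewrite <- Hinit.
    pose proof (truncated_laplace_by_parts lambda T (extend (p i j)) g) as H.
    rewrite <- (Rplus_minus (extend (p i j) 0) (exp (- lambda * T) * extend (p i j) T)).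
    rewrite H; auto; [ring|].
    intros t Ht. rewrite Hinit. now apply tf_forward_integral with M. }
  assert (Hlhs : filterlim lhs (Rbar_locally p_infty)
                   (locally (0 + lambda * resolvent p lambda i j))).
  { apply filterlim_add; [|now apply filterlim_mult_const, resolvent_lim with M].
    apply (filterlim_le_le (F := Rbar_locally p_infty) (fun _ => 0) _
             (fun T => exp (- lambda * T)) 0).
    - exists 0. intros T HT. rewrite extend_pos by lra.
      pose proof (exp_pos (- lambda * T)).
      pose proof (tf_ge0 p Hp i j T ltac:(lra)).
      pose proof (tf_le1 p i j T Hp ltac:(lra)). nra.
    - apply filterlim_const.
    - now apply exp_scal_lim_0. }
  assert (Hrhs : filterlim rhs (Rbar_locally p_infty)
     (locally (kron i j + sum_n (fun k => resolvent p lambda i k * q k j) N))).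
  { apply filterlim_add; [apply filterlim_const|].
    apply filterlim_sum_n. intros k.
    apply filterlim_ext with (fun T => q k j * truncated_laplace lambda (extend (p i k)) T);
      [intros; ring|].
    rewrite Rmult_comm. now apply filterlim_mult_const, resolvent_lim with M. }
  assert (0 + lambda * resolvent p lambda i j
     = kron i j + sum_n (fun k => resolvent p lambda i k * q k j) N).
  { apply Rle_antisym.
    - refine (filterlim_p_infty_le _ _ _ _ _ Hlhs Hrhs). intros T HT. right; auto.
    - refine (filterlim_p_infty_le _ _ _ _ _ Hrhs Hlhs). intros T HT. right; symmetry; auto. }
  lra.
Qed.

(** A zero diagonal rate forces [p 0 0 t = 1], so no mass is left for other
    states. *)
Lemma resolvent_0_pos (p : nat -> nat -> R -> R) (q : nat -> nat -> R)
  (M lambda : R) (j : nat) :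
  transition_function p -> has_q_matrix p q -> linear_escape p M ->
  q 0%nat 0%nat = 0 -> 0 < lambda -> (1 <= j)%nat -> resolvent p lambda 0 j = 0.
Proof.
  intros Hp Hq HM H0 Hl Hj.
  assert (Hz : forall t, 0 <= t -> p 0%nat j t = 0).
  { intros t Ht.
    assert (Hd : right_derive (p 0%nat 0%nat) 0 (q 0%nat 0%nat)).
    { unfold right_derive.
      apply right_lim_ext with (fun h => (p 0%nat 0%nat h - p 0%nat 0%nat 0) / h).
      - intros x _. now rewrite Rplus_0_l.
      - apply Hq. }
    apply tf_diag_lower with (t := t) in Hd; [|exact Hp|exact Ht].
    rewrite H0, Rmult_0_l in Hd.
    destruct (tf_row_is_series p 0 t Hp Ht) as (r & Hr & Hs).
    apply (is_series_two_terms_le _ _ 0 j) in Hs; [|lia|intros; now apply (tf_ge0 p Hp)].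
    pose proof (tf_ge0 p Hp 0%nat j t Ht). lra. }
  apply Rle_antisym; [|now apply resolvent_ge0 with M].
  refine (filterlim_p_infty_le _ (fun _ => 0) _ _ _ (resolvent_lim p M lambda 0 j Hp HM Hl)
            (filterlim_const _)).
  intros T HT. unfold truncated_laplace.
  rewrite (RInt_ext _ (fun _ => 0)).
  - rewrite RInt_const. right. apply Rmult_0_r.
  - intros t. rewrite Rmin_left by exact HT. intros [Ht _].
    rewrite extend_pos by lra. rewrite Hz by lra. apply Rmult_0_r.
Qed.

(** * The root of [U] *)

Lemma queue_rates_sum (b : nat -> R) : queue_rates b -> is_series b 0.
Proof.
  intros Hb.
  pose proof (is_series_add _ _ _ _ (qr_sum b Hb) (is_series_kron b 1)) as H.
  replace (- b 1%nat + b 1%nat) with 0 in H by ring.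
  eapply is_series_ext; [|exact H].
  intros k. unfold kron. simpl. destruct (k =? 1)%nat; ring.
Qed.

Lemma queue_rates_Rabs_sum (b : nat -> R) :
  queue_rates b -> is_series (fun k => Rabs (b k)) (-2 * b 1%nat).
Proof.
  intros Hb.
  pose proof (is_series_sub _ _ _ _ (qr_sum b Hb) (is_series_kron b 1)) as H.
  replace (- b 1%nat - b 1%nat) with (-2 * b 1%nat) in H by ring.
  eapply is_series_ext; [|exact H].
  intros k. unfold kron. simpl. pose proof (qr_ge0 b Hb k). pose proof (qr_b1 b Hb).
  destruct (Nat.eqb_spec k 1) as [->|Hk].
  - rewrite Rabs_left by lra. ring.
  - rewrite Rabs_pos_eq by auto. ring.
Qed.

Lemma pow_le_one (s : R) (k : nat) : -1 <= s <= 1 -> Rabs (s ^ k) <= 1.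
Proof.
  intros Hs. rewrite <- RPow_abs. rewrite <- (pow1 k).
  apply pow_incr. split; [apply Rabs_pos|apply Rabs_le; lra].
Qed.

Lemma ex_series_Bgen_abs (b : nat -> R) (s : R) :
  queue_rates b -> -1 <= s <= 1 -> ex_series (fun k => Rabs (b k * s ^ k)).
Proof.
  intros Hb Hs.
  eapply ex_series_ext; [|apply (ex_series_bounded_mult (fun k => Rabs (b k)) (fun k => s ^ k) 1)].
  - intros k. cbv beta. rewrite !Rabs_mult, Rabs_Rabsolu. reflexivity.
  - intros k. apply Rabs_pos.
  - intros k. now apply pow_le_one.
  - eexists. now apply queue_rates_Rabs_sum.
Qed.

Lemma Bgen_series (b : nat -> R) (s : R) :
  queue_rates b -> -1 <= s <= 1 -> is_series (fun k => b k * s ^ k) (Bgen b s).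
Proof.
  intros Hb Hs. apply Series_correct, ex_series_Rabs. now apply ex_series_Bgen_abs.
Qed.

(** Conservativity of the rates. *)
Lemma Bgen_1 (b : nat -> R) : queue_rates b -> Bgen b 1 = 0.
Proof.
  intros Hb. apply is_series_unique.
  eapply is_series_ext; [|exact (queue_rates_sum b Hb)].
  intros k. rewrite pow1. symmetry. apply Rmult_1_r.
Qed.

Lemma pow_convex (s t : R) (n : nat) :
  0 <= s <= t -> t <= 1 -> (1 - s) * t ^ n <= (1 - t) * s ^ n + (t - s).
Proof.
  intros Hs Ht. induction n as [|n IH]; [simpl; lra|].
  assert (Hsn : 0 <= s ^ n <= 1).
  { split; [apply pow_le; lra|]. rewrite <- (pow1 n). apply pow_incr; lra. }
  apply Rmult_le_compat_l with (r := t) in IH; [|lra].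
  assert (0 <= (t - s) * ((1 - t) * (1 - s ^ n))).
  { repeat apply Rmult_le_pos; lra. }
  simpl. lra.
Qed.

(** Convexity of [Bgen] between [s] and [1], where it vanishes. The coefficient
    [b 1] is negative, but [s ^ 1] is affine and contributes an equality. *)
Lemma Bgen_convex (b : nat -> R) (s t : R) :
  queue_rates b -> 0 <= s <= t -> t <= 1 -> (1 - s) * Bgen b t <= (1 - t) * Bgen b s.
Proof.
  intros Hb Hs Ht.
  replace ((1 - t) * Bgen b s) with ((1 - t) * Bgen b s + (t - s) * 0) by ring.
  refine (is_series_le _ _ _ _ _
    (is_series_mult_const_l (1 - s) _ _ (Bgen_series b t Hb ltac:(lra)))
    (is_series_add _ _ _ _
       (is_series_mult_const_l (1 - t) _ _ (Bgen_series b s Hb ltac:(lra)))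
       (is_series_mult_const_l (t - s) _ _ (queue_rates_sum b Hb)))).
  intros n. destruct (Nat.eq_dec n 1) as [->|Hn]; [simpl; right; ring|].
  pose proof (pow_convex s t n Hs Ht) as H. pose proof (qr_ge0 b Hb n Hn).
  apply Rmult_le_compat_l with (r := b n) in H; [lra|assumption].
Qed.

Lemma U_1 (c : nat) (b : nat -> R) (lambda : R) :
  queue_rates b -> U c b lambda 1 = - lambda.
Proof. intros Hb. unfold U, Bsrv. rewrite Bgen_1 by exact Hb. ring. Qed.

Lemma U_0 (c : nat) (b : nat -> R) (lambda : R) : U c b lambda 0 = INR c * b 0%nat.
Proof. unfold U, Bsrv, Bgen. rewrite PSeries_0. ring. Qed.

Lemma U_convex (c : nat) (b : nat -> R) (lambda s t : R) :
  queue_rates b -> 0 <= s <= t -> t <= 1 ->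
  (1 - s) * U c b lambda t <= (1 - t) * U c b lambda s + (t - s) * U c b lambda 1.
Proof.
  intros Hb Hs Ht. rewrite U_1 by exact Hb. unfold U, Bsrv.
  pose proof (Bgen_convex b s t Hb Hs Ht). lra.
Qed.

Lemma U_continuous (c : nat) (b : nat -> R) (lambda s : R) :
  queue_rates b -> 0 <= s < 1 -> continuity_pt (U c b lambda) s.
Proof.
  intros Hb Hs. apply continuity_pt_filterlim.
  unfold U, Bsrv.
  apply (continuous_minus (V := R_NormedModule)
           (fun s => Bgen b s + (INR c - 1) * b 0%nat * (1 - s)) (fun s => lambda * s)).
  - apply (continuous_plus (V := R_NormedModule)).
    + apply continuity_pt_filterlim, PSeries_continuity.
      rewrite Rabs_pos_eq by lra.
      apply Rbar_lt_le_trans with 1; [simpl; lra|].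
      apply (CV_radius_bounded b). exists (-2 * b 1%nat). intros n.
      rewrite pow1, Rmult_1_r.
      apply (is_series_term_le (fun k => Rabs (b k))); [intros; apply Rabs_pos|].
      now apply queue_rates_Rabs_sum.
    + apply (ex_derive_continuous (V := R_NormedModule)). auto_derive. exact I.
  - apply (ex_derive_continuous (V := R_NormedModule)). auto_derive. exact I.
Qed.

(** [U] is convex on [[0, 1]], positive at [0] and negative at [1]. The
    intermediate value theorem gives a root, and convexity forbids a second one
    before [1]. *)
Lemma U_root (c : nat) (b : nat -> R) (lambda : R) :
  (1 <= c)%nat -> queue_rates b -> 0 < lambda ->
  exists u, 0 < u /\ unique (fun s => 0 <= s <= 1 /\ U c b lambda s = 0) u.
Proof.
  intros Hc Hb Hl.
  assert (A0 : 0 < INR c * b 0%nat).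
  { apply Rmult_lt_0_compat; [now apply lt_0_INR|apply (qr_b0 b Hb)]. }
  assert (HU1 := U_1 c b lambda Hb). assert (HU0 := U_0 c b lambda).
  set (A := INR c * b 0%nat) in *.
  (* at this point the chord from [(0, A)] to [(1, - lambda)] is below the axis *)
  set (t0 := 2 * A / (2 * A + lambda)).
  assert (Ht0 : 0 < t0 < 1).
  { unfold t0. split; [apply Rdiv_lt_0_compat; lra|].
    apply Rmult_lt_reg_r with (2 * A + lambda); [lra|]. field_simplify; lra. }
  assert (HUt0 : U c b lambda t0 < 0).
  { pose proof (U_convex c b lambda 0 t0 Hb ltac:(lra) ltac:(lra)) as H.
    rewrite HU1, HU0 in H.
    assert (E : (1 - t0) * A + (t0 - 0) * - lambda = - (A * lambda / (2 * A + lambda)))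
      by (unfold t0; field; lra).
    rewrite E in H.
    assert (0 < A * lambda / (2 * A + lambda))
      by (apply Rdiv_lt_0_compat; [apply Rmult_lt_0_compat|]; lra).
    lra. }
  destruct (IVT_interv (fun s => - U c b lambda s) 0 t0) as (u & Hu & HUu).
  - intros a Ha. apply continuity_pt_opp, U_continuous; [exact Hb|lra].
  - lra.
  - rewrite HU0. lra.
  - lra.
  - assert (HU : U c b lambda u = 0) by lra.
    (* to the right of a root, convexity puts [U] below a chord ending at [- lambda < 0] *)
    assert (K : forall s t, 0 <= s -> s < t -> t <= 1 ->
              U c b lambda s = 0 -> U c b lambda t = 0 -> False).
    { intros s t Hs Hst Ht H1 H2.
      pose proof (U_convex c b lambda s t Hb ltac:(lra) Ht) as H.
      rewrite H1, H2, HU1 in H. nra. }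
    exists u. split.
    + destruct (Req_dec u 0) as [->|]; lra.
    + split; [split; [lra|exact HU]|].
      intros x [Hx HUx]. destruct (Rtotal_order u x) as [H|[H|H]]; [|exact H|];
        exfalso; [apply (K u x)|apply (K x u)]; auto; lra.
Qed.

(** * The generating function of the resolvent *)

Lemma Qstar_linear_escape (c : nat) (b : nat -> R) (p : nat -> nat -> R -> R) :
  queue_rates b -> transition_function p -> has_q_matrix p (Qstar c b) ->
  linear_escape p (INR c * b 0%nat - b 1%nat).
Proof.
  intros Hb Hp Hq k h Hh.
  assert (Hd : right_derive (p k k) 0 (Qstar c b k k)).
  { unfold right_derive. apply right_lim_ext with (fun h => (p k k h - p k k 0) / h).
    - intros x _. now rewrite Rplus_0_l.
    - apply Hq. }
  apply tf_diag_lower with (t := h) in Hd; [|exact Hp|exact Hh].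
  assert (HQ : b 1%nat - INR c * b 0%nat <= Qstar c b k k).
  { pose proof (qr_b0 b Hb). pose proof (qr_b1 b Hb). pose proof (pos_INR c).
    assert (INR (Nat.min k c) * b 0%nat <= INR c * b 0%nat).
    { apply Rmult_le_compat_r; [lra|]. apply le_INR. lia. }
    unfold Qstar. rewrite Nat.eqb_refl.
    destruct (Nat.eqb_spec k 0); [nra|].
    destruct (Nat.eqb_spec (k + 1) k); [lia|]. lra. }
  apply Rmult_le_compat_r with (r := h) in HQ; [|exact Hh]. lra.
Qed.

Lemma Qstar_column_finite (c : nat) (b : nat -> R) (j k : nat) :
  (S j < k)%nat -> Qstar c b k j = 0.
Proof.
  intros H. unfold Qstar.
  destruct (Nat.eqb_spec k 0); [reflexivity|].
  destruct (Nat.eqb_spec (j + 1) k); [lia|].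
  destruct (Nat.eqb_spec j k); [lia|].
  destruct (Nat.ltb_spec k j); [lia|reflexivity].
Qed.

(** The absorbing state [0] is the only one from which the queue does not move. *)
Definition active_part (x : nat -> R) (k : nat) : R := if Nat.eqb k 0 then 0 else x k.

(** From a state [k >= 1] the queue moves by the rates [b], shifted, plus
    [min k c - 1] additional servers, each working at rate [b 0]. *)
Definition extra_service (c : nat) (b x : nat -> R) (k : nat) : R :=
  active_part x k * ((INR (Nat.min k c) - 1) * b 0%nat).

(** Arrivals and the first server act by translation, hence a convolution with
    [b]; each further server moves mass from [k] to [k - 1], hence a difference of
    consecutive terms. *)
Lemma Qstar_convolution (c : nat) (b x : nat -> R) (j : nat) :
  sum_n (fun k => x k * Qstar c b k j) (S j)
  = sum_n (fun k => active_part x k * b (S j - k)%nat) (S j)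
    + extra_service c b x (S j) - extra_service c b x j :> R.
Proof.
  rewrite (sum_n_eq _ (fun k => active_part x k * b (S j - k)%nat
     + (extra_service c b x k * kron k (S j)
        + (-1 * extra_service c b x k) * kron k j))).
  - rewrite !sum_n_add, !sum_n_kron by lia. ring.
  - intros k Hk.
    unfold Qstar, extra_service, active_part, kron.
    destruct (Nat.eqb_spec k 0); [ring|].
    destruct (Nat.eqb_spec (j + 1) k), (Nat.eqb_spec k (S j)); try lia.
    + destruct (Nat.eqb_spec k j); [lia|].
      replace (S j - k)%nat with 0%nat by lia. ring.
    + destruct (Nat.eqb_spec j k), (Nat.eqb_spec k j); try lia.
      * subst k. replace (S j - j)%nat with 1%nat by lia. ring.
      * destruct (Nat.ltb_spec k j); [|lia].
        replace (S j - k)%nat with (j - k + 1)%nat by lia. ring.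
Qed.

(** With [c] busy servers the factor would be the constant [(c - 1) * b 0]; only
    the finitely many states [1 <= k < c] fall short of it, by [(c - k) * b 0]. *)
Lemma extra_service_series (c : nat) (b x : nat -> R) (s Y : R) :
  is_series (fun k => active_part x k * s ^ k) Y ->
  is_series (fun k => extra_service c b x k * s ^ k)
    ((INR c - 1) * b 0%nat * Y
     - sum_n_m (fun k => x k * s ^ k * ((INR c - INR k) * b 0%nat)) 1 (c - 1)).
Proof.
  intros HY.
  set (z := fun k => if andb (1 <=? k)%nat (k <? c)%nat
                     then x k * s ^ k * ((INR c - INR k) * b 0%nat) else 0).
  assert (HZ : is_series z
    (sum_n_m (fun k => x k * s ^ k * ((INR c - INR k) * b 0%nat)) 1 (c - 1))).
  { replace (sum_n_m _ _ _) with (sum_n z (c - 1)).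
    - apply is_series_finite. intros k Hk. unfold z.
      destruct (Nat.ltb_spec k c); [lia|]. now rewrite Bool.andb_false_r.
    - unfold sum_n. rewrite sum_Sn_m by lia.
      change (z 0%nat) with (zero (G := R_AbelianGroup)). rewrite plus_zero_l.
      apply sum_n_m_ext_loc. intros k Hk. unfold z.
      destruct (Nat.leb_spec 1 k), (Nat.ltb_spec k c); try lia. reflexivity. }
  eapply is_series_ext;
    [|apply (is_series_sub _ _ _ _ (is_series_mult_const_l ((INR c - 1) * b 0%nat) _ _ HY) HZ)].
  intros k.
  assert ((INR c - 1) * b 0%nat * (active_part x k * s ^ k) - z k
          = extra_service c b x k * s ^ k); [|assumption].
  unfold z, extra_service, active_part.
  destruct (Nat.eqb_spec k 0) as [->|]; [simpl; ring|].
  destruct (Nat.leb_spec 1 k); [|lia].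
  destruct (Nat.ltb_spec k c); simpl.
  - rewrite Nat.min_l by lia. ring.
  - rewrite Nat.min_r by lia. ring.
Qed.

(** Multiply the forward equation for [j] by [s ^ (j + 1)] and sum over [j]. The
    convolution becomes a product of series and the difference of consecutive
    terms a factor [1 - s]. The product is Cauchy's product of absolutely
    convergent series, which also covers [s = 1] and [s = -1]. *)
Lemma generating_identity (c : nat) (b x : nat -> R) (lambda s : R) (i : nat) :
  queue_rates b -> -1 <= s <= 1 ->
  (forall j, 0 <= x j) -> ex_series x ->
  (forall j, lambda * x j - kron i j = sum_n (fun k => x k * Qstar c b k j) (S j)) ->
  exists L : R, is_series (fun j => x j * s ^ j) L /\
    U c b lambda s * L
    = Bsrv b c s * x 0%nat
      + sum_n_m (fun k => x k * s ^ k * (Bsrv b c s - Bsrv b k s)) 1 (c - 1)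
      - s ^ (i + 1).
Proof.
  intros Hb Hs Hx Hex Hfwd.
  assert (HxL : ex_series (fun k => Rabs (x k * s ^ k))).
  { apply ex_series_bounded_mult with 1; auto. intros k. now apply pow_le_one. }
  destruct (ex_series_Rabs _ HxL) as [L HL]. exists L. split; [exact HL|].
  assert (HY : is_series (fun k => active_part x k * s ^ k) (L - x 0%nat)).
  { replace (x 0%nat) with (x 0%nat * s ^ 0) by (simpl; ring).
    eapply is_series_ext;
      [|apply (is_series_sub _ _ _ _ HL (is_series_kron (fun k => x k * s ^ k) 0))].
    intros k. unfold active_part, kron. simpl. destruct (k =? 0)%nat; ring. }
  assert (HYabs : ex_series (fun k => Rabs (active_part x k * s ^ k))).
  { apply (ex_series_le (V := R_CompleteNormedModule) _ (fun k => Rabs (x k * s ^ k)));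
      [|exact HxL].
    intros k. change (Rabs (Rabs (active_part x k * s ^ k)) <= Rabs (x k * s ^ k)).
    rewrite Rabs_Rabsolu. unfold active_part. destruct (k =? 0)%nat; [|apply Rle_refl].
    rewrite Rmult_0_l, Rabs_R0. apply Rabs_pos. }
  pose proof (is_series_mult _ _ _ _ HY (Bgen_series b s Hb Hs) HYabs
                (ex_series_Bgen_abs b s Hb Hs)) as HYB.
  pose proof (extra_service_series c b x s _ HY) as HW.
  set (S1 := sum_n_m (fun k => x k * s ^ k * ((INR c - INR k) * b 0%nat)) 1 (c - 1)) in HW.
  set (W := (INR c - 1) * b 0%nat * (L - x 0%nat) - S1) in HW.
  pose proof (is_series_sub _ _ _ _ (is_series_add _ _ _ _ HYB HW)
                (is_series_shift s _ _ HW)) as HR.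
  pose proof (is_series_shift s _ _
                (is_series_sub _ _ _ _ (is_series_mult_const_l lambda _ _ HL)
                   (is_series_kron (fun k => s ^ k) i))) as HLs.
  (* both sides have the same coefficients, by the forward equation *)
  assert (E : s * (lambda * L - s ^ i) = (L - x 0%nat) * Bgen b s + W - s * W).
  { apply is_series_unique in HLs. apply is_series_unique in HR.
    rewrite <- HLs, <- HR. apply Series_ext. intros [|j].
    - unfold extra_service, active_part. simpl. ring.
    - assert (HC : sum_f_R0 (fun k => active_part x k * s ^ k * (b (S j - k)%nat * s ^ (S j - k))) (S j)
                   = s ^ S j * sum_n (fun k => active_part x k * b (S j - k)%nat) (S j)).
      { rewrite <- sum_n_Reals, <- sum_n_mult_const. apply sum_n_ext_loc. intros k Hk.
        replace (s ^ S j) with (s ^ k * s ^ (S j - k)) by (rewrite <- pow_add; f_equal; lia).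
        change (active_part x k * s ^ k * (b (S j - k)%nat * s ^ (S j - k))
                = s ^ k * s ^ (S j - k) * (active_part x k * b (S j - k)%nat)). ring. }
      rewrite HC.
      pose proof (Qstar_convolution c b x j) as HQ. rewrite <- Hfwd in HQ.
      replace (sum_n (fun k => active_part x k * b (S j - k)%nat) (S j))
        with (lambda * x j - kron i j - extra_service c b x (S j) + extra_service c b x j)
        by (rewrite HQ; ring).
      replace (kron j i) with (kron i j) by (unfold kron; now rewrite Nat.eqb_sym).
      simpl. ring. }
  assert (HS : sum_n_m (fun k => x k * s ^ k * (Bsrv b c s - Bsrv b k s)) 1 (c - 1)
               = (1 - s) * S1).
  { unfold S1. rewrite <- (sum_n_m_mult_l (K := R_Ring) (1 - s)).
    apply sum_n_m_ext. intros k. unfold Bsrv, mult; simpl. ring. }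
  rewrite HS. unfold W in E. unfold U, Bsrv. rewrite pow_add, pow_1.
  lra.
Qed.

Theorem theorem2p2 :
  forall (c : nat) (b : nat -> R) (p : nat -> nat -> R -> R) (lambda : R),
  (1 <= c)%nat ->
  queue_rates b ->
  transition_function p ->
  has_q_matrix p (Qstar c b) ->
  0 < lambda ->
  (forall (i : nat) (s : R), -1 <= s <= 1 -> U c b lambda s <> 0 ->
     is_series (fun j : nat => resolvent p lambda i j * s ^ j)
       ((Bsrv b c s * resolvent p lambda i 0
         + sum_n_m (fun k : nat =>
             resolvent p lambda i k * s ^ k * (Bsrv b c s - Bsrv b k s)) 1 (c - 1)
         - s ^ (i + 1)) / U c b lambda s))
  /\ resolvent p lambda 0 0 = 1 / lambda
  /\ (exists u : R,
        unique (fun s : R => 0 <= s <= 1 /\ U c b lambda s = 0) u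
        /\ forall i : nat, (1 <= i)%nat ->
             resolvent p lambda i 0
             = (u ^ i
                - sum_n_m (fun k : nat =>
                    resolvent p lambda i k * u ^ (k - 1)
                    * (INR c - INR k) * b 0%nat * (1 - u)) 1 (c - 1)) / lambda)
  /\ (forall j : nat, (1 <= j)%nat -> resolvent p lambda 0 j = 0).
Proof.
  intros c b p lambda Hc Hb Hp Hq Hl.
  pose proof (Qstar_linear_escape c b p Hb Hp Hq) as HM.
  set (M := INR c * b 0%nat - b 1%nat) in HM.
  assert (Hfwd : forall i j, lambda * resolvent p lambda i j - kron i j
            = sum_n (fun k => resolvent p lambda i k * Qstar c b k j) (S j)).
  { intros i j. apply resolvent_forward with M; auto.
    intros k Hk. now apply Qstar_column_finite. }
  assert (Hgen := fun i s Hs => generating_identity c b (resolvent p lambda i) lambda s i Hb Hs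
            (fun j => resolvent_ge0 p M lambda i j Hp HM Hl)
            (ex_series_resolvent p M lambda i Hp HM Hl) (Hfwd i)).
  assert (H0 : forall j, (1 <= j)%nat -> resolvent p lambda 0 j = 0).
  { intros j Hj. now apply resolvent_0_pos with (Qstar c b) M. }
  split; [|split; [|split; [|exact H0]]].
  - intros i s Hs HU. destruct (Hgen i s Hs) as (L & HL & E).
    rewrite <- E.
    assert (EL : L = U c b lambda s * L / U c b lambda s) by (field; exact HU).
    rewrite <- EL. exact HL.
  - pose proof (Hfwd 0%nat 0%nat) as H. rewrite sum_Sn, sum_O, (H0 1%nat) in H by lia.
    change (lambda * resolvent p lambda 0 0 - 1
            = resolvent p lambda 0 0 * 0 + 0 * Qstar c b 1 0) in H.
    apply Rmult_eq_reg_l with lambda; [|lra].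
    replace (lambda * (1 / lambda)) with 1 by (field; lra). lra.
  - destruct (U_root c b lambda Hc Hb Hl) as (u & u0 & Hu).
    exists u. split; [exact Hu|]. intros i Hi.
    destruct Hu as [[Hu HU] _].
    destruct (Hgen i u ltac:(lra)) as (L & _ & E).
    assert (HB : Bsrv b c u = lambda * u) by (unfold U in HU; lra).
    rewrite HU, Rmult_0_l, HB in E.
    assert (HS : sum_n_m (fun k => resolvent p lambda i k * u ^ k * (lambda * u - Bsrv b k u)) 1 (c - 1)
      = u * sum_n_m (fun k => resolvent p lambda i k * u ^ (k - 1)
                    * (INR c - INR k) * b 0%nat * (1 - u)) 1 (c - 1)).
    { rewrite <- (sum_n_m_mult_l (K := R_Ring) u).
      apply sum_n_m_ext_loc. intros k Hk. rewrite <- HB. unfold Bsrv, mult; simpl.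
      replace (u ^ k) with (u * u ^ (k - 1)); [ring|].
      replace k with (S (k - 1)) at 2 by lia. reflexivity. }
    rewrite HS in E. rewrite pow_add, pow_1 in E.
    set (Z := sum_n_m _ 1 (c - 1)) in *.
    apply Rmult_eq_reg_l with (u * lambda); [|nra].
    replace (u * lambda * ((u ^ i - Z) / lambda)) with (u * (u ^ i - Z)) by (field; lra).
    lra.
Qed.
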